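(* There is a polynomial $p(x)\in\mathbb{Q}[x]$ such that for all positive integers $n,k$ with $k<n$: if $n>p(k)$, then $-k$ is the only negative eigenvalue in the spectrum of (the adjacency matrix of) the arrangement graph $A(n,k)$ (that is, $-k$ is an eigenvalue and no other eigenvalue is negative).
   Context: For a positive integer $m$ put $I_m=\{1,\dots,m\}$. For $k\le n$, a $k$-permutation is an injective map $\sigma:I_k\to I_n$. The $(n,k)$-arrangement graph $A(n,k)$ has as vertices all $k$-permutations, two of them being joined by an edge if and only if they agree as functions on exactly $k-1$ elements of $I_k$. *)

(* Defs.v *)
From HB Require Import structures.
From mathcomp Require Import all_boot all_order all_algebra all_field.

Set Implicit Arguments.
Unset Strict Implicit.
Unset Printing Implicit Defensive.

Import Order.TTheory GRing.Theory Num.Theory.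
Local Open Scope ring_scope.

(* I_m = {1, ..., m} is represented by 'I_m = {0, ..., m - 1}. *)
Definition kperm (n k : nat) : finType :=
  {s : {ffun 'I_k -> 'I_n} | injectiveb s}.

(* The cardinal is compared to k - 1 without truncated subtraction. *)
Definition arrangement_adj (n k : nat) : rel (kperm n k) :=
  fun s t => (#|[set i : 'I_k | val s i == val t i]|.+1 == k)%N.

(* The entries are in algC, an algebraically closed field containing all the
   complex eigenvalues of a 0/1 matrix; a < 0 in algC implies that a is real. *)
Definition adjacency_mx (T : finType) (e : rel T) : 'M[algC]_#|T| :=
  \matrix_(i, j) (e (enum_val i) (enum_val j))%:R.

Definition arrangement_mx (n k : nat) : 'M[algC]_#|kperm n k| :=
  adjacency_mx (@arrangement_adj n k).

(* Main.v *)
Require Import Defs.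
From HB Require Import structures.
From mathcomp Require Import all_boot all_order all_algebra all_field.
From mathcomp Require Import ring zify.

Set Implicit Arguments.
Unset Strict Implicit.
Unset Printing Implicit Defensive.

Import Order.TTheory GRing.Theory Num.Theory.
Local Open Scope ring_scope.

(** The proof is a spectral gap argument, and gives the linear bound p = 3x.

    Fix i and call two k-permutations collinear in direction i when they agree
    outside i. Each line has N = n - k + 1 points, and if A is the adjacency
    matrix then A + k = M, where M is the sum over i of the 0/1 matrices L_i of
    collinearity in direction i ([arrangement_mxE]). Each L_i is the matrix of
    an equivalence relation, so M is positive semidefinite, all eigenvalues of
    A are at least -k, and it remains to show that M has no eigenvalue strictly
    between 0 and k.

    Compute M^2. As L_i^2 = N L_i ([line_sqr]), only the products L_i L_j with
    i <> j matter. Inside a class of k-permutations that agree outside i and j,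
    a point is an ordered pair of distinct values; one can go from (a, b) to
    (a', b') by changing first a and then b unless a' = b. Hence
    L_i L_j = F_ij - C_ij with F_ij the relation of being in the same class and
    C_ij the exceptional pairs with a' = b ([line_mul]). The matrix F_ij is
    positive semidefinite, and so is L_i + L_j - C_ij - C_ji: on a function f
    it takes the value sum_c |u_c - w_c|^2, where u_c and w_c are the sums of f
    over the points of the class whose first, respectively second, value is c.
    Thus L_i L_j + L_j L_i + L_i + L_j is positive semidefinite
    ([psd_line_pair]), and adding up over i <> j shows that
    M^2 - (N - (k - 1)) M is positive semidefinite ([psd_gap_sum_line]). A
    positive eigenvalue of M is therefore at least N - k + 1 = n - 2k + 2,
    which is at least k as soon as n >= 3k - 2 ([arrangement_spectral_gap]).

    Finally -k is an eigenvalue when n >= 2k ([eigenvalue_opp_k]): the vector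
    whose value at s is the product over l of the signs g_l(s(l)), with
    g_l = 1 at 2l, -1 at 2l + 1 and 0 elsewhere, has sum zero on every line. *)

(** * Positive semidefinite matrices *)

Definition herm_form (m : nat) (K : 'M[algC]_m) (v : 'rV[algC]_m) : algC :=
  (v *m K *m (map_mx Num.conj v)^T) 0 0.

Definition psd (m : nat) (K : 'M[algC]_m) : Prop :=
  forall v, 0 <= herm_form K v.

Lemma herm_formE m (K : 'M[algC]_m) v :
  herm_form K v = \sum_s \sum_t v 0 s * (v 0 t)^* * K s t.
Proof.
rewrite /herm_form mxE exchange_big /=; apply: eq_bigr => t _.
rewrite !mxE mulr_suml; apply: eq_bigr => s _.
by rewrite mulrAC.
Qed.

Lemma psdD m (K L : 'M[algC]_m) : psd K -> psd L -> psd (K + L).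
Proof.
by move=> pK pL v; rewrite /herm_form mulmxDr mulmxDl mxE addr_ge0 ?pK ?pL.
Qed.

Lemma psd_sum m (I : finType) (P : pred I) (K : I -> 'M[algC]_m) :
  (forall i, P i -> psd (K i)) -> psd (\sum_(i | P i) K i).
Proof.
move=> pK; apply: big_ind => //; last exact: psdD.
by move=> v; rewrite /herm_form mulmx0 mul0mx mxE.
Qed.

(** Up to a diagonal rescaling by [x], the matrix of the relation of having the
    same key: its form is a sum, over the keys, of squared moduli of the sums
    over the fibers. Every positivity fact of the proof is an instance. *)
Lemma psd_fibers (T I : finType) (key : T -> I) (x : T -> algC)
    (K : 'M[algC]_#|T|) :
  (forall i j, K i j = x (enum_val i) * (x (enum_val j))^*
                       * (key (enum_val i) == key (enum_val j))%:R) ->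
  psd K.
Proof.
move=> KE v; rewrite herm_formE.
pose y i := v 0 i * x (enum_val i).
suff -> : \sum_s \sum_t v 0 s * (v 0 t)^* * K s t =
  \sum_q `|\sum_(s | key (enum_val s) == q) y s| ^+ 2.
  by apply: sumr_ge0 => q _; rewrite exprn_ge0.
transitivity (\sum_q \sum_(s | key (enum_val s) == q)
    \sum_(t | key (enum_val t) == q) y s * (y t)^*); last first.
  by apply: eq_bigr => q _; rewrite normCK rmorph_sum big_distrlr.
rewrite [RHS](exchange_big_dep predT) //=; apply: eq_bigr => s _.
rewrite (big_pred1 (key (enum_val s))); last by move=> q; rewrite eq_sym.
rewrite [RHS]big_mkcond; apply: eq_bigr => t _.
rewrite KE [key (enum_val t) == _]eq_sym.
case: eqP => _; last by rewrite !mulr0.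
by rewrite /y mulr1 rmorphM mulrACA.
Qed.

Lemma herm_form_eigen m (K : 'M[algC]_m) v a :
  v *m K = a *: v -> herm_form K v = a * herm_form 1%:M v.
Proof. by rewrite /herm_form mulmx1 => ->; rewrite -scalemxAl mxE. Qed.

Lemma herm_form1_gt0 m (v : 'rV[algC]_m) : v != 0 -> 0 < herm_form 1%:M v.
Proof.
move=> v0; rewrite /herm_form mulmx1 mxE.
under eq_bigr => i _ do rewrite !mxE -normCK.
have ge0 i : true -> 0 <= `|v 0 i| ^+ 2 by move=> _; rewrite exprn_ge0.
rewrite lt_def sumr_ge0 // andbT psumr_eq0 //.
apply: contra v0 => /allP z; apply/eqP/rowP=> i; rewrite mxE.
by have /z := mem_index_enum i; rewrite expf_eq0 /= normr_eq0 => /eqP.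
Qed.

(** * Lines of k-permutations *)

Section Lines.
Variables n k : nat.
Local Notation T := (kperm n k).
Implicit Types (s t r : T) (i j l : 'I_k) (A : {set 'I_k}).

(** The restriction to A, as a value in a finite type, so that [agree A] is the
    fiber relation of a key and [psd_fibers] applies. *)
Definition restrict A s : {ffun 'I_k -> option 'I_n} :=
  [ffun l => if l \in A then Some (val s l) else None].

Definition agree A : rel T := fun s t => restrict A s == restrict A t.

Lemma agreeP A s t :
  reflect (forall l, l \in A -> val s l = val t l) (agree A s t).
Proof.
apply: (iffP eqP) => [/ffunP E l lA | E].
  by have := E l; rewrite !ffunE lA => -[].
by apply/ffunP=> l; rewrite !ffunE; case: ifP => // lA; rewrite E.
Qed.

Lemma kperm_inj s : injective (val s).
Proof. exact/injectiveP/(valP s). Qed.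

Lemma kpermP s t : (forall l, val s l = val t l) -> s = t.
Proof. by move=> E; apply/val_inj/ffunP. Qed.

Lemma agree_setC1_inj i s t :
  agree [set~ i] s t -> val s i = val t i -> s = t.
Proof.
move=> /agreeP E Ei; apply: kpermP => l; have [->//|li] := eqVneq l i.
by apply: E; rewrite !inE.
Qed.

(** The only obstruction to changing one value is injectivity. *)
Lemma kperm_update s i c : c \notin val s @: [set~ i] ->
  exists2 r, agree [set~ i] s r & val r i = c.
Proof.
move=> cs; pose f := [ffun l => if l == i then c else val s l].
have f_inj : injectiveb f.
  apply/injectiveP=> a b; rewrite !ffunE.
  case: eqP => [->|/eqP ai]; case: eqP => [->|/eqP bi] //.
  - by move=> E; case/negP: cs; rewrite E imset_f ?inE.
  - by move=> E; case/negP: cs; rewrite -E imset_f ?inE.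
  - exact: kperm_inj.
exists (exist _ f f_inj : T); last by rewrite /= ffunE eqxx.
by apply/agreeP=> l; rewrite !inE /= ffunE => /negPf->.
Qed.

Lemma line_inj s i :
  {in [set r | agree [set~ i] s r] &, injective (fun r : T => val r i)}.
Proof.
move=> r t; rewrite !inE => sr st; apply: agree_setC1_inj.
by rewrite /agree -(eqP sr) -(eqP st).
Qed.

Lemma line_imset s i :
  [set val r i | r : T in [set r | agree [set~ i] s r]] = ~: (val s @: [set~ i]).
Proof.
apply/setP=> c; rewrite [RHS]inE; apply/imsetP/idP => [[r]|cs].
  rewrite inE => /agreeP E ->; apply/imsetP=> -[l li].
  by rewrite E // => /kperm_inj il; rewrite -il !inE eqxx in li.
by have [r sr <-] := kperm_update cs; exists r; rewrite ?inE.
Qed.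

(** A point of a line is determined by its free coordinate, which ranges over
    the values not taken by the other coordinates. *)
Lemma big_line s i (F : 'I_n -> algC) :
  \sum_(r | agree [set~ i] s r) F (val r i) =
  \sum_(c | c \notin val s @: [set~ i]) F c.
Proof.
transitivity (\sum_(c in [set val r i | r : T in [set r | agree [set~ i] s r]]) F c).
  rewrite big_imset /=; first by apply: eq_bigl => r; rewrite inE.
  exact: line_inj.
by rewrite line_imset; apply: eq_bigl => c; rewrite inE.
Qed.

Lemma card_line s i : #|[set r | agree [set~ i] s r]| = (n - k.-1)%N.
Proof.
have <- : #|[set val r i | r : T in [set r | agree [set~ i] s r]]| =
          #|[set r | agree [set~ i] s r]|.
  exact/card_in_imset/line_inj.
rewrite line_imset cardsCs setCK card_ord (card_imset _ (@kperm_inj s)).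
by rewrite cardsC1 card_ord.
Qed.

Definition line i : 'M[algC]_#|T| := adjacency_mx (agree [set~ i]).

Lemma adjacency_mxM (R S : rel T) x y :
  (adjacency_mx R *m adjacency_mx S) x y =
  #|[set r | R (enum_val x) r && S r (enum_val y)]|%:R.
Proof.
rewrite mxE -sum1_card natr_sum (reindex (@enum_val T T)) /=; last first.
  by exists (@enum_rank T) => [z _|z _]; rewrite ?enum_valK ?enum_rankK.
rewrite [RHS]big_mkcond; apply: eq_bigr => z _; rewrite !mxE !inE.
by rewrite -natrM mulnb; case: (_ && _).
Qed.

Lemma line_sqr i : line i *m line i = (n - k.-1)%:R *: line i.
Proof.
apply/matrixP=> x y; rewrite adjacency_mxM !mxE.
case: (boolP (agree _ _ _)) => [/eqP xy|Nxy]; last first.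
  rewrite mulr0 (_ : [set _ | _] = set0) ?cards0 //.
  apply/setP=> r; rewrite !inE; apply/negP=> /andP[/eqP xr /eqP ry].
  by case/negP: Nxy; rewrite /agree xr ry.
rewrite mulr1 -(card_line (enum_val x) i); congr _%:R; apply: eq_card => r.
by rewrite !inE /agree -xy [restrict _ r == _]eq_sym andbb.
Qed.

Lemma agree_setC1 i j s t : i != j ->
  agree [set~ j] s t = agree (~: [set i; j]) s t && (val s i == val t i).
Proof.
move=> ij; apply/agreeP/andP => [E|[/agreeP E /eqP Ei] l].
  split; last by apply/eqP/E; rewrite !inE.
  by apply/agreeP => l; rewrite !inE negb_or => /andP[_ lj]; apply: E; rewrite !inE.
rewrite !inE => lj; have [->//|li] := eqVneq l i.
by apply: E; rewrite !inE negb_or li.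
Qed.

(** A path from s to t that changes coordinate i and then coordinate j has its
    middle point forced, with values t i at i and s j at j. That point exists
    when s and t agree elsewhere, except when these two values collide. *)
Lemma line_mul i j x y : i != j ->
  (line i *m line j) x y =
  (agree (~: [set i; j]) (enum_val x) (enum_val y))%:R
  * (1 - (val (enum_val x) j == val (enum_val y) i)%:R).
Proof.
move=> ij; have ji : j != i by rewrite eq_sym.
rewrite adjacency_mxM.
move: (enum_val x) (enum_val y) => s t.
have rP r : agree [set~ i] s r -> agree [set~ j] r t ->
  [/\ agree (~: [set i; j]) s t, val r i = val t i & val r j = val s j].
  rewrite (agree_setC1 _ _ ij) (agree_setC1 _ _ ji) (setUC [set j]).
  by case/andP=> /eqP sr /eqP -> /andP[/eqP rt /eqP ->]; rewrite /agree sr rt.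
case: (boolP (agree (~: _) s t)) => [st|Nst]; last first.
  rewrite mul0r (_ : [set _ | _] = set0) ?cards0 //.
  apply/setP=> r; rewrite !inE; apply/negP=> /andP[sr rt].
  by have [] := rP r sr rt; rewrite (negPf Nst).
rewrite mul1r; case: (eqVneq (val s j) (val t i)) => [E|NE].
  rewrite subrr (_ : [set _ | _] = set0) ?cards0 //.
  apply/setP=> r; rewrite !inE; apply/negP=> /andP[sr rt].
  have [_ ri rj] := rP r sr rt.
  by move: E; rewrite -ri -rj => /kperm_inj E; rewrite E eqxx in ij.
rewrite subr0.
have /kperm_update[r sr ri] : val t i \notin val s @: [set~ i].
  apply/imsetP=> -[l]; rewrite !inE => li tl.
  have [lj|lj] := eqVneq l j; first by rewrite tl lj eqxx in NE.
  move: tl; rewrite (agreeP _ _ _ st) ?inE ?negb_or ?li //.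
  by move/kperm_inj=> il; rewrite il eqxx in li.
rewrite (_ : [set _ | _] = [set r]) ?cards1 //.
apply/setP=> r'; rewrite !inE; apply/andP/eqP => [[sr' rt']|->].
  have [_ ri' _] := rP r' sr' rt'.
  by apply: (@agree_setC1_inj i); rewrite ?ri ?ri' // /agree -(eqP sr) -(eqP sr').
split=> //; rewrite (agree_setC1 _ _ ij) ri eqxx andbT.
move: sr st; rewrite (agree_setC1 _ _ ji) (setUC [set j]) => /andP[+ _].
by rewrite /agree => /eqP->.
Qed.

Lemma psd_line i : psd (line i).
Proof.
apply: (@psd_fibers _ _ (restrict [set~ i]) (fun=> 1)) => x y.
by rewrite mxE conjC1 !mul1r.
Qed.

(** The collisions subtracted in [line_mul] are absorbed by the two lines: with
    [x c] the difference of the indicators of value c at i and at j, the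
    matrices [D c] add up to line i + line j minus both collision matrices. *)
Lemma psd_line_pair i j : i != j ->
  psd (line i *m line j + line j *m line i + (line i + line j)).
Proof.
move=> ij; pose F : 'M[algC]_#|T| := adjacency_mx (agree (~: [set i; j])).
pose x c s : algC := (val s i == c)%:R - (val s j == c)%:R.
pose D c : 'M[algC]_#|T| := \matrix_(a, b)
  (x c (enum_val a) * (x c (enum_val b))^*
   * (agree (~: [set i; j]) (enum_val a) (enum_val b))%:R).
suff -> : line i *m line j + line j *m line i + (line i + line j) =
          F + F + \sum_c D c.
  apply: psdD; last first.
    apply: psd_sum => c _.
    by apply: (@psd_fibers _ _ (restrict (~: [set i; j])) (x c)) => a b; rewrite mxE.
  have pF : psd F.
    apply: (@psd_fibers _ _ (restrict (~: [set i; j])) (fun=> 1)) => a b.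
    by rewrite mxE conjC1 !mul1r.
  exact: psdD.
have ji : j != i by rewrite eq_sym.
apply/matrixP=> a b.
rewrite [LHS]mxE [X in X + _ = _]mxE [X in _ + X = _]mxE.
rewrite [RHS]mxE [X in _ = X + _]mxE (line_mul _ _ ij) (line_mul _ _ ji) summxE.
under eq_bigr => c _ do rewrite mxE.
rewrite -mulr_suml !mxE (agree_setC1 _ _ ij) (agree_setC1 _ _ ji).
rewrite (setUC [set j]).
move: (enum_val a) (enum_val b) => s t.
have sum_delta (u w : 'I_n) :
    \sum_c (u == c)%:R * (w == c)%:R = (u == w)%:R :> algC.
  rewrite (bigD1 u) //= eqxx mul1r [w == u]eq_sym big1 ?addr0 // => c.
  by rewrite eq_sym => /negPf->; rewrite mul0r.
have -> : \sum_c x c s * (x c t)^* =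
  (val s i == val t i)%:R - (val s i == val t j)%:R
  - (val s j == val t i)%:R + (val s j == val t j)%:R.
  rewrite -!sum_delta -!sumrB -big_split /=; apply: eq_bigr => c _.
  rewrite /x rmorphB /= !conjC_nat mulrBl !mulrBr opprB.
  by rewrite addrA addrAC.
case: (agree _ s t); rewrite ?mul1r ?mul0r ?mulr1 ?mulr0 ?addr0 //=.
by ring.
Qed.

(** If D is the set where s and t differ, then they are collinear in direction i
    exactly when D is contained in {i}: this holds for all k directions if D is
    empty, for one direction if s and t are adjacent, and for none otherwise. *)
Lemma arrangement_mxE :
  arrangement_mx n k + k%:R%:M = \sum_i line i.
Proof.
apply/matrixP=> x y; rewrite summxE !mxE.
under eq_bigr => i _ do rewrite mxE.
rewrite -(inj_eq enum_val_inj).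
move: (enum_val x) (enum_val y) => s t.
rewrite /arrangement_adj.
set A := [set _ | _].
have lineE i : agree [set~ i] s t = (~: A \subset [set i]).
  rewrite subCset; apply/agreeP/subsetP => E l /E; rewrite inE.
    by move/eqP.
  by move/eqP.
under eq_bigr => i _ do rewrite lineE subset1.
have cardD : (#|A| + #|~: A| = k)%N by rewrite cardsC card_ord.
have -> : (s == t) = (~: A == set0).
  rewrite -setCT (inj_eq (@setC_inj _)); apply/eqP/eqP => [st|AT].
    by apply/setP=> i; rewrite !inE st eqxx.
  by apply: kpermP => i; apply/eqP; have := in_setT i; rewrite -AT inE.
move: (~: A) cardD => D cardD; have [D0|D0] := eqVneq D set0.
  under eq_bigr => i _ do rewrite orbT.
  move: cardD; rewrite D0 cards0 addn0 => ->.
  by rewrite -{2}[k]addn0 -addn1 eqn_add2l add0r sumr_const card_ord.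
under eq_bigr => i _ do rewrite orbF.
have -> : (#|A|.+1 == k) = (#|D| == 1%N).
  by rewrite -(eqn_add2l #|A| #|D|) cardD addn1 eq_sym.
rewrite addr0.
have [/cards1P[l Dl]|NDl] := boolP (#|D| == 1%N).
  rewrite Dl (bigD1 l) //= eqxx big1 ?addr0 // => i.
  by rewrite (inj_eq (@set1_inj _)) eq_sym => /negPf->.
rewrite big1 // => i _; case: eqP => // Di.
by rewrite Di cards1 in NDl.
Qed.

Lemma psd_sum_line : psd (\sum_i line i).
Proof. by apply: psd_sum => i _; apply: psd_line. Qed.

(** Positivity of M (M - (N - (k - 1))) with N = n - k + 1, obtained by adding
    up [psd_line_pair]. A product of two distinct lines is not symmetric, so the
    two orders have to be taken together, whence the factor 2. *)
Lemma psd_gap_sum_line :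
  let M := \sum_i line i in
  psd ((M *m M - (n - k.-1)%:R *: M + k.-1%:R *: M) *+ 2).
Proof.
move=> M.
have sqrE : M *m M - (n - k.-1)%:R *: M =
    \sum_i \sum_(j | j != i) line i *m line j.
  rewrite mulmx_suml scaler_sumr -sumrB; apply: eq_bigr => i _.
  by rewrite mulmx_sumr (bigD1 i) //= line_sqr addrAC subrr add0r.
have linE : k.-1%:R *: M = \sum_i \sum_(j | j != i) line i.
  rewrite scaler_sumr; apply: eq_bigr => i _.
  by rewrite sumr_const scaler_nat cardC1 card_ord.
have swap (G : 'I_k -> 'I_k -> 'M[algC]_#|T|) :
    \sum_i \sum_(j | j != i) G i j = \sum_i \sum_(j | j != i) G j i.
  rewrite (exchange_big_dep predT) //=; apply: eq_bigr => i _.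
  by apply: eq_bigl => j; rewrite eq_sym.
rewrite sqrE linE mulr2n addrACA.
rewrite [X in _ + X + _](swap (fun i j => line i *m line j)).
rewrite [X in _ + (_ + X)](swap (fun i j => line i)).
rewrite -!big_split /=; apply: psd_sum => i _.
rewrite -!big_split /=; apply: psd_sum => j; rewrite eq_sym.
exact: psd_line_pair.
Qed.

(** * A vector with zero sum on every line *)

Definition pair_sign l (c : 'I_n) : algC :=
  (c == l.*2 :> nat)%:R - (c == l.*2.+1 :> nat)%:R.

Definition sign_vector : 'rV[algC]_#|T| :=
  \row_(x < #|T|) \prod_l pair_sign l (val (enum_val x) l).

Lemma pair_sign_neq0 l c : pair_sign l c != 0 -> l = c./2 :> nat.
Proof.
rewrite /pair_sign; case: (_ =P l.*2) => [->|_]; first by rewrite doubleK.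
case: (_ =P l.*2.+1) => [->|_]; first by rewrite /= uphalf_double.
by rewrite subrr eqxx.
Qed.

Lemma sum_pair_sign l : (k.*2 <= n)%N -> \sum_c pair_sign l c = 0.
Proof.
move=> k2n.
have lt1 : (l.*2.+1 < n)%N.
  by apply: leq_trans k2n; rewrite -doubleS leq_double.
have sum_delta m (lt_m : (m < n)%N) : \sum_(c < n) (c == m :> nat)%:R = 1 :> algC.
  rewrite (bigD1 (Ordinal lt_m)) //= eqxx big1 ?addr0 // => c.
  by rewrite -val_eqE /= => /negPf->.
by rewrite sumrB !sum_delta ?subrr // ltnW.
Qed.

(** Along a line in direction i, only the factor at i varies. If the other
    factors are nonzero, the values that they use avoid 2i and 2i + 1, so that
    the missing values contribute nothing and the sum over the line is proportional
    to the full sum of the signs at i, which is zero. *)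
Lemma sign_vector_line i : (k.*2 <= n)%N -> sign_vector *m line i = 0.
Proof.
move=> k2n.
apply/rowP=> y; rewrite !mxE; set t := enum_val y.
transitivity (\sum_(r | agree [set~ i] t r) \prod_l pair_sign l (val r l)).
  rewrite [RHS](reindex (@enum_val T T)) /=; last first.
    by exists (@enum_rank T) => [z _|z _]; rewrite ?enum_valK ?enum_rankK.
  rewrite [RHS]big_mkcond; apply: eq_bigr => x _; rewrite !mxE.
  rewrite /agree [restrict _ t == _]eq_sym.
  by case: ifP => _; rewrite ?mulr1 ?mulr0.
pose P := \prod_(l | l != i) pair_sign l (val t l).
transitivity (\sum_(r | agree [set~ i] t r) pair_sign i (val r i) * P).
  apply: eq_bigr => r /agreeP E; rewrite (bigD1 i) //=; congr (_ * _).
  by apply: eq_bigr => l li; rewrite E // !inE.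
rewrite -mulr_suml big_line.
have [->|/prodf_neq0 P0] := eqVneq P 0; first by rewrite mulr0.
suff -> : \sum_(c | c \notin val t @: [set~ i]) pair_sign i c = 0.
  by rewrite mul0r.
rewrite -[RHS](sum_pair_sign i k2n).
rewrite [RHS](bigID [pred c | c \in val t @: [set~ i]]) /=.
rewrite [X in _ = X + _]big1 ?add0r //.
move=> c /imsetP[l]; rewrite !inE => li ->.
apply/eqP/negPn/negP => /pair_sign_neq0 il.
have /pair_sign_neq0 ll := P0 l li.
by case/eqP: li; apply: val_inj; rewrite /= ll -il.
Qed.

Lemma sign_vector_neq0 : (k.*2 <= n)%N -> sign_vector != 0.
Proof.
move=> k2n.
have dbl_lt l : (l.*2 < n)%N by apply: leq_trans k2n; rewrite ltn_double.
pose f := [ffun l : 'I_k => Ordinal (dbl_lt l)].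
have f_inj : injectiveb f.
  by apply/injectiveP=> a b; rewrite !ffunE => -[/double_inj/val_inj].
apply/eqP=> /rowP/(_ (enum_rank (exist _ f f_inj : T))).
rewrite !mxE enum_rankK big1 => [/eqP|l _]; first by rewrite oner_eq0.
by rewrite /pair_sign /= ffunE /= eqxx -[X in X == _]addn0 -addn1 eqn_add2l subr0.
Qed.

End Lines.

(** * Spectrum of the arrangement graph *)

Lemma arrangement_spectral_gap n k a : (k.*2 + k.-1 <= n.+1)%N ->
  eigenvalue (arrangement_mx n k) a -> a < 0 -> a = - k%:R.
Proof.
move=> kn /eigenvalueP[v va v0] a_lt0.
pose M := \sum_i @line n k i.
have vM : v *m M = (a + k%:R) *: v.
  by rewrite /M -arrangement_mxE mulmxDr va mul_mx_scalar scalerDl.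
set mu := a + k%:R in vM.
have mu_lt : mu < k%:R by rewrite /mu gtrDr.
have q_gt0 := herm_form1_gt0 v0.
have mu_ge0 : 0 <= mu.
  by rewrite -(pmulr_lge0 _ q_gt0) -(herm_form_eigen vM); apply: psd_sum_line.
have [mu0|mu_neq0] := eqVneq mu 0.
  by apply/eqP; rewrite -addr_eq0 -/mu mu0.
have mu_gt0 : 0 < mu by rewrite lt_def mu_neq0.
(* On v the gap matrix acts as twice mu (mu - (N - (k - 1))); since mu > 0, this
   forces mu >= N - (k - 1) >= k, against mu < k. *)
have vK : v *m ((M *m M - (n - k.-1)%:R *: M + k.-1%:R *: M) *+ 2) =
    ((mu - (n - k.-1)%:R + k.-1%:R) * mu *+ 2) *: v.
  rewrite [in LHS]mulr2n [in RHS]mulr2n mulmxDr scalerDl; congr (_ + _);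
  rewrite mulmxDr mulmxBr mulmxA -!scalemxAr !vM -scalemxAl vM;
  by rewrite !scalerA -scalerBl -scalerDl -mulrBl -mulrDl.
have := @psd_gap_sum_line n k v; rewrite (herm_form_eigen vK).
rewrite (pmulr_lge0 _ q_gt0) pmulrn_lge0 // (pmulr_lge0 _ mu_gt0).
rewrite addrAC subr_ge0 => /le_lt_trans/(_ (ltr_leD mu_lt (lexx k.-1%:R))).
rewrite -natrD ltr_nat => lt_nk.
exfalso; lia.
Qed.

Lemma eigenvalue_opp_k n k : (k.*2 <= n)%N ->
  eigenvalue (arrangement_mx n k) (- k%:R).
Proof.
move=> k2n; apply/eigenvalueP; exists (sign_vector n k).
  rewrite -[arrangement_mx n k](addrK k%:R%:M) arrangement_mxE mulmxBr.
  rewrite mulmx_sumr big1 => [|i _]; last exact: sign_vector_line.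
  by rewrite sub0r mul_mx_scalar scaleNr.
exact: sign_vector_neq0.
Qed.

Theorem proposition4p1 :
  exists p : {poly rat},
    forall n k : nat, (0 < k)%N -> (k < n)%N ->
      p.[k%:R] < n%:R ->
      eigenvalue (arrangement_mx n k) (- k%:R) /\
      (forall a : algC, eigenvalue (arrangement_mx n k) a -> a < 0 -> a = - k%:R).
Proof.
exists (3%:R *: 'X) => n k _ _.
rewrite hornerZ hornerX -natrM ltr_nat => k3n.
split; first by apply: eigenvalue_opp_k; lia.
by move=> a; apply: arrangement_spectral_gap => //; lia.
Qed.
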